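(* Let $(X,d,\mu)$ be a reverse doubling space. Given $0<\eta<1$, fix $\varepsilon$ with $0<\varepsilon<\min\{\eta,1-\eta\}$. Then there exists a constant $C=C(\eta,\varepsilon,X)$ such that for every $f\in L^1_{loc}(X)$ and for every $x\in X$, $$|I_\eta f(x)|\leq C\,\big(M_{\eta-\varepsilon}f(x)\,M_{\eta+\varepsilon}f(x)\big)^{1/2}.$$
   Context: A quasi-metric space $(X,d)$ is a set $X$ with $d:X\times X\to[0,\infty)$ such that $d(x,y)=0$ iff $x=y$, $d(x,y)=d(y,x)$, and $d(x,y)\le A_0(d(x,z)+d(y,z))$ for all $x,y,z$ and some constant $A_0\ge1$. Write $B(x,r)$ for the ball with center $x$ and radius $r$. $(X,d,\mu)$ is a space of homogeneous type if $(X,d)$ is a quasi-metric space, $\mu$ is a positive measure defined on the $\sigma$-algebra generated by quasi-metric balls and open sets, $0<\mu(B)<\infty$ for every ball $B$, and there is $C_\mu\ge1$ with $\mu(B(x,2r))\le C_\mu\,\mu(B(x,r))$ for all $x\in X$, $r>0$. A reverse doubling space is a space of homogeneous type for which there is a constant $0<\gamma<1$ such that $\mu(B(x,r/2))\le\gamma\,\mu(B(x,r))$ for every $x\in X$ and $r>0$ with $B(x,r)\subsetneq X$. $L^1_{loc}(X)$ denotes the measurable functions that are integrable on every ball. Fractional integral operator: for $0<\eta<1$, $$I_\eta f(x)=\int_X\frac{f(y)}{\mu\big(B(x,d(x,y))\big)^{1-\eta}}\,d\mu(y).$$ Fractional maximal operator: for $0\le\eta<1$, $$M_\eta f(x)=\sup_{B\ni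 x}\mu(B)^{\eta}\,\frac1{\mu(B)}\int_B|f|\,d\mu,$$ the supremum being over all balls $B$ containing $x$ (the value may be $+\infty$). *)

(* Defs.v *)
From HB Require Import structures.
From mathcomp Require Import all_boot all_order all_algebra.
From mathcomp Require Import all_classical all_reals all_analysis.

Set Implicit Arguments.
Unset Strict Implicit.
Unset Printing Implicit Defensive.

Import Order.TTheory GRing.Theory Num.Theory.
Import numFieldNormedType.Exports.

Local Open Scope classical_set_scope.
Local Open Scope ring_scope.

Definition is_quasi_metric (R : realType) (X : Type) (d : X -> X -> R) : Prop :=
  [/\ forall x y, 0 <= d x y,
      forall x y, d x y = 0 <-> x = y,
      forall x y, d x y = d y x &
      exists2 A0 : R, 1 <= A0 &
        forall x y z, d x y <= A0 * (d x z + d y z)].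

Definition qball (R : realType) (X : Type) (d : X -> X -> R) (x : X) (r : R) :
  set X := [set y | d x y < r].

Definition qopen (R : realType) (X : Type) (d : X -> X -> R) : set (set X) :=
  [set U | forall x, U x -> exists2 r : R, 0 < r & qball d x r `<=` U].

(* When d is only a quasi-metric, balls need not be open, nor even Borel for
   the topology qopen d, so they are added to the generators. *)
Definition qgen (R : realType) (X : Type) (d : X -> X -> R) : set (set X) :=
  [set B | exists x (r : R), 0 < r /\ B = qball d x r] `|` qopen d.

Notation qspace d := (g_sigma_algebraType (qgen d)).

Definition homogeneous_type (R : realType) (X : pointedType) (d : X -> X -> R)
    (mu : {measure set (qspace d) -> \bar R}) : Prop :=
  [/\ is_quasi_metric d,
      forall x (r : R), 0 < r -> (0 < mu (qball d x r) < +oo)%E &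
      exists2 Cmu : R, 1 <= Cmu &
        forall x (r : R), 0 < r ->
          (mu (qball d x (2 * r)) <= Cmu%:E * mu (qball d x r))%E].

Definition reverse_doubling_space (R : realType) (X : pointedType)
    (d : X -> X -> R) (mu : {measure set (qspace d) -> \bar R}) : Prop :=
  homogeneous_type mu /\
  exists2 gamma : R, 0 < gamma < 1 &
    forall x (r : R), 0 < r -> qball d x r `<` setT ->
      (mu (qball d x (r / 2)) <= gamma%:E * mu (qball d x r))%E.

Definition L1loc (R : realType) (X : pointedType) (d : X -> X -> R)
    (mu : {measure set (qspace d) -> \bar R}) (f : qspace d -> R) : Prop :=
  measurable_fun setT f /\
  forall x (r : R), 0 < r -> mu.-integrable (qball d x r) (EFin \o f).

(* At y = x the ball B(x, 0) is empty, and division by 0 in R makes the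
   integrand 0 there. This is immaterial when mu [set x] = 0, which in a reverse
   doubling space can fail only if X is a single point. When the integrals of
   the positive and negative parts are both infinite, the library's value is
   -oo, of absolute value +oo. *)
Definition frac_integral (R : realType) (X : pointedType) (d : X -> X -> R)
    (mu : {measure set (qspace d) -> \bar R}) (eta : R) (f : qspace d -> R)
    (x : X) : \bar R :=
  (\int[mu]_y (f y / fine (mu (qball d x (d x y))) `^ (1 - eta))%:E)%E.

Definition frac_maximal (R : realType) (X : pointedType) (d : X -> X -> R)
    (mu : {measure set (qspace d) -> \bar R}) (eta : R) (f : qspace d -> R)
    (x : X) : \bar R :=
  ereal_sup [set e : \bar R | exists z (r : R),
    [/\ 0 < r, qball d z r x &
        e = (((fine (mu (qball d z r))) `^ eta)%:E *
             (((fine (mu (qball d z r)))^-1)%:E *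
              \int[mu]_(y in qball d z r) `|f y|%:E))%E]].

(* Main.v *)
(* Put V y = mu (B(x, d(x, y))) and decompose X along the level sets of V
   instead of dyadic annuli. By doubling, {0 < V <= s} is exhausted by balls
   centred at x of measure at most Cmu s, so the integral of |f| over it is at
   most (Cmu s)^(1 - a) M_a f(x). On {s <= V <= e s} the integral of
   |f| V^(eta - 1) is therefore O(s^(eta - a)) M_a f(x). For a threshold t, use
   a = eta - eps on the levels below t and a = eta + eps on those above: both
   sums over s = t e^k are geometric, so |I_eta f(x)| is
   O(t^eps M_(eta-eps) f(x) + t^-eps M_(eta+eps) f(x)); then optimise in t. *)

Require Import Defs.
From HB Require Import structures.
From mathcomp Require Import all_boot all_order all_algebra.
From mathcomp Require Import all_classical all_reals all_analysis.
From mathcomp Require Import measurable_realfun ring lra.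
Import Order.TTheory GRing.Theory Num.Theory.
Import numFieldNormedType.Exports.
Local Open Scope classical_set_scope.
Local Open Scope ring_scope.

(** * Integration over the unit layers of a nonnegative function *)

Section layers.
Context {dsp : measure_display} {T : measurableType dsp} {R : realType}.
Variables (mu : {measure set T -> \bar R}) (D : set T) (u : T -> R).
Variable g : T -> \bar R.
Hypotheses (mD : measurable D) (u_meas : measurable_fun D u).
Hypotheses (mg : measurable_fun D g).
Hypothesis u0 : forall y, D y -> 0 <= u y.
Hypothesis g0 : forall y, D y -> (0 <= g y)%E.

Let layer (n : nat) := D `&` [set y | n%:R <= u y < n.+1%:R].

Let measurable_layer n : measurable (layer n).
Proof.
rewrite /layer (_ : [set y | _] = u @^-1` `[n%:R, n.+1%:R[).
  exact: u_meas.
by apply/seteqP; split => y /=; rewrite in_itv.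
Qed.

Let measurable_sublevel (c : R) : measurable (D `&` [set y | u y < c]).
Proof.
rewrite (_ : [set y | _] = u @^-1` `]-oo, c[); first exact: u_meas.
by apply/seteqP; split => y /=; rewrite in_itv.
Qed.

Let integral_layers :
  (\int[mu]_(y in D) g y = \sum_(0 <= n <oo) \int[mu]_(y in layer n) g y)%E.
Proof.
have DE : D = \bigcup_n layer n.
  apply/seteqP; split => [y Dy|y [n _ []//]].
  by exists (Num.trunc (u y)) => //; split => //; apply: truncn_itv; exact: u0.
rewrite [in LHS]DE ge0_integral_bigcup// -?DE//.
apply/trivIsetP => i j _ _; apply: contra_neqP => /eqP/set0P[y].
move=> [[_ /andP[iu ui]] [_ /andP[ju uj]]].
have := le_lt_trans iu uj; have := le_lt_trans ju ui.
by rewrite !ltr_nat !ltnS => ji ij; apply/eqP; rewrite eqn_leq ij ji.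
Qed.

(** The layers partition [D], and since [u >= 0] the first [n] of them make up exactly the sublevel
    set [u < n], so each partial sum of the layer integrals is one of the bounded integrals. With
    [u] the distance to [x], this reduces an estimate to sets of bounded distance. *)
Lemma ge0_integral_le_sublevels (K : \bar R) :
  (forall n : nat, \int[mu]_(y in D `&` [set y | (u y < n%:R)%R]) g y <= K)%E ->
  (\int[mu]_(y in D) g y <= K)%E.
Proof.
move=> gK; rewrite integral_layers; apply: lime_le.
  apply: is_cvg_nneseries => n _ _; apply: integral_ge0 => y [Dy _]; exact: g0.
apply: nearW => n; apply: le_trans (gK n); rewrite big_mkord.
rewrite le_eqVlt; apply/orP; left; apply/eqP.
elim: n => [|n IH].
  rewrite big_ord0 (_ : _ `&` _ = set0) ?integral_set0//.
  apply/seteqP; split => y //= [Dy]; rewrite ltNge => /negP; apply; exact: u0.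
rewrite big_ord_recr/= IH -ge0_integral_setU//=.
- congr (integral _ _ _); apply/seteqP; split => y /=.
    case=> -[Dy]; last by case/andP.
    by move=> h; split=> //; rewrite (lt_le_trans h)// ler_nat.
  move=> [Dy h]; have [/= nu|un] := lerP n%:R (u y); last by left.
  by right; split=> //; apply/andP.
- by apply: measurable_funS mg => // y [] [].
- by move=> y [] [Dy _]; exact: g0.
- apply/eqP/seteqP; split => // y /= [[_ h] [_ /andP[h1 _]]].
  by move: (lt_le_trans h h1); rewrite ltxx.
Qed.

(** Countable additivity over the layers, followed by comparison with a geometric series. It is
    applied on each side of the threshold [t] with [u = |ln V - ln t|] and [rho = expR (- eps)]. *)
Lemma ge0_integral_le_geometric (rho : R) (K : \bar R) :
  0 < rho < 1 -> (0 <= K)%E ->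
  (forall n : nat, \int[mu]_(y in D `&` [set y | (n%:R <= u y < n.+1%:R)%R]) g y
     <= (rho ^+ n)%:E * K)%E ->
  (\int[mu]_(y in D) g y <= ((1 - rho)^-1)%:E * K)%E.
Proof.
move=> /andP[rho0 rho1] K0 gK; rewrite integral_layers; apply: lime_le.
  apply: is_cvg_nneseries => n _ _; apply: integral_ge0 => y [Dy _]; exact: g0.
apply: nearW => n.
apply: (@le_trans _ _ (\sum_(0 <= k < n) (rho ^+ k)%:E * K)%E).
  by apply: lee_sum => k _; exact: gK.
rewrite -ge0_sume_distrl; last by move=> k _; rewrite lee_fin exprn_ge0// ltW.
rewrite lee_wpmul2r// sumEFin lee_fin.
have := @geometric_le_lim R n 1 rho ler01 rho0.
rewrite gtr0_norm// => /(_ rho1); rewrite mul1r; apply: le_trans.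
rewrite /series/= le_eqVlt; apply/orP; left; apply/eqP/eq_bigr => k _.
by rewrite mul1r.
Qed.

End layers.

(** * Balls and the volume function V *)

Section homogeneous.
Context {R : realType} {X : pointedType} {d : X -> X -> R}.
Context {mu : {measure set (qspace d) -> \bar R}}.
Hypothesis hX : homogeneous_type mu.

Let d0 x y : 0 <= d x y.
Proof. by case: hX => -[]. Qed.

Lemma qball_le0 (x : X) (r : R) : r <= 0 -> qball d x r = set0.
Proof.
move=> r0; apply/seteqP; split => y //=; rewrite /qball/= ltNge.
by rewrite (le_trans r0 (d0 x y)).
Qed.

Lemma measurable_qball (x : X) (r : R) :
  measurable (qball d x r : set (qspace d)).
Proof.
have [r0|r0] := ltP 0 r; last by rewrite qball_le0.
by apply: sub_sigma_algebra; left; exists x, r.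
Qed.

Lemma measurable_qdist (x : X) : measurable_fun setT (d x : qspace d -> R).
Proof.
apply: (measurability _ (RGenInftyO.measurableE R)).
move=> _ [_ [r ->] <-]; rewrite setTI.
rewrite (_ : _ @^-1` _ = qball d x r); first exact: measurable_qball.
by apply/seteqP; split => y /=; rewrite in_itv.
Qed.

Lemma mu_qball_fin_num (x : X) (r : R) : mu (qball d x r) \is a fin_num.
Proof.
have [r0|r0] := ltP 0 r; last by rewrite qball_le0// measure0.
case: hX => _ /(_ x r r0)/andP[h1 h2] _.
by rewrite ge0_fin_numE// ltW.
Qed.

Lemma le_mu_qball (x : X) :
  {homo (fun r : R => fine (mu (qball d x r))) : r s / r <= s}.
Proof.
move=> r s rs; rewrite fine_le ?mu_qball_fin_num//.
apply: le_measure; rewrite ?inE; [exact: measurable_qball..|].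
by move=> y; rewrite /qball/= => /lt_le_trans; apply.
Qed.

(** This is the V of the overview. It vanishes at [y = x], where the ball has radius 0 and is
    empty. *)
Definition qvol (x y : X) : R := fine (mu (qball d x (d x y))).

Lemma qvol_ge0 (x y : X) : 0 <= qvol x y.
Proof. exact: fine_ge0. Qed.

(** V is a nondecreasing function of the radius composed with the distance to [x], and monotone real
    functions are measurable. *)
Lemma measurable_qvol (x : X) : measurable_fun setT (qvol x : qspace d -> R).
Proof.
have mW : measurable_fun setT (fun r : R => fine (mu (qball d x r))).
  by apply: nondecreasing_measurable => //; exact: le_mu_qball.
exact: measurableT_comp mW (measurable_qdist x).
Qed.

Lemma qvol_gt0_qdist (x y : X) : 0 < qvol x y -> 0 < d x y.
Proof.
rewrite /qvol; have [//|r0] := ltP 0 (d x y).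
by rewrite qball_le0// measure0 ltxx.
Qed.

Lemma mu_qball_gt0 (x : X) (r : R) : 0 < r -> 0 < fine (mu (qball d x r)).
Proof.
by move=> r0; case: hX => _ /(_ x r r0) h _; rewrite fine_gt0.
Qed.

(** * Integrals over balls and the fractional maximal function *)

Section maximal.
Variable f : qspace d -> R.
Hypothesis mf : measurable_fun setT f.

Let mabsf (D : set (qspace d)) : measurable_fun D (fun y => `|f y|%:E).
Proof.
apply/measurable_EFinP/measurableT_comp => //; exact: measurable_funS mf.
Qed.

Lemma frac_maximal_ge0 (a : R) (x : X) : (0 <= frac_maximal mu a f x)%E.
Proof.
apply: le_trans (ereal_sup_ubound _); last first.
  exists x, 1; split; [by []| |reflexivity].
  by rewrite /qball/=; case: hX => -[_ /(_ x x)[_ ->]].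
by rewrite !mule_ge0// ?lee_fin ?powR_ge0 ?invr_ge0 ?fine_ge0// integral_ge0.
Qed.

Lemma integral_qball_le (a : R) (x z : X) (r : R) : 0 < r -> qball d z r x ->
  (\int[mu]_(y in qball d z r) `|f y|%:E <=
   ((fine (mu (qball d z r))) `^ (1 - a))%:E * frac_maximal mu a f x)%E.
Proof.
move=> r0 zx; have m0 := mu_qball_gt0 z r r0.
set m := fine _ in m0 *; set I := (\int[mu]_(y in _) _)%E.
rewrite (_ : I = (m `^ (1 - a))%:E * ((m `^ a)%:E * (m^-1%:E * I)))%E.
  rewrite lee_wpmul2l ?lee_fin ?powR_ge0//.
  by apply: ereal_sup_ubound; exists z, r.
rewrite !muleA -!EFinM -powRD ?(gt_eqF m0) ?implybT//.
by rewrite subrK powRr1 ?(ltW m0)// divff ?mul1e ?(gt_eqF m0).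
Qed.

(** Either vanishing means that [|f|] has integral 0 over every ball containing [x], a condition
    free of the exponent. This settles the degenerate case of the final optimisation. *)
Lemma frac_maximal_eq0 (a b : R) (x : X) :
  frac_maximal mu a f x = 0%E -> frac_maximal mu b f x = 0%E.
Proof.
move=> fa0; apply/eqP; rewrite eq_le frac_maximal_ge0 andbT.
apply: ge_ereal_sup => _ [z [r [r0 zx ->]]].
have -> : (\int[mu]_(y in qball d z r) `|f y|%:E = 0)%E.
  apply/eqP; rewrite eq_le integral_ge0// andbT.
  by apply: le_trans (integral_qball_le a x z r r0 zx) _; rewrite fa0 mule0.
by rewrite !mule0.
Qed.

(** * Sublevel sets of V under doubling *)

Section doubling.
Variable Cmu : R.
Hypothesis Cmu1 : 1 <= Cmu.
Hypothesis doubling : forall x (r : R), 0 < r ->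
  (mu (qball d x (2 * r)) <= Cmu%:E * mu (qball d x r))%E.

Let doublingr x (r : R) : 0 < r ->
  fine (mu (qball d x (2 * r))) <= Cmu * fine (mu (qball d x r)).
Proof.
move=> /(doubling x) h; rewrite -lee_fin EFinM !fineK//;
  exact: mu_qball_fin_num.
Qed.

(** Truncate to [d x y < n], so that the distances have a finite supremum [s]. A point [y] of the
    truncated set with [d x y > s / 2] gives a ball [B(x, 2 d(x, y))] containing that set, and
    doubling bounds its measure by [Cmu * qvol x y <= Cmu * t], uniformly in [n]. *)
Lemma integral_qvol_le (a t : R) (x : X) : a <= 1 -> 0 < t ->
  (\int[mu]_(y in [set y | (0 < qvol x y <= t)%R]) `|f y|%:E <=
   ((Cmu * t) `^ (1 - a))%:E * frac_maximal mu a f x)%E.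
Proof.
move=> a1 t0; set D := [set y | _].
have mD : measurable (D : set (qspace d)).
  rewrite (_ : D = setT `&` qvol x @^-1` `]0, t]); first exact: measurable_qvol.
  by rewrite setTI; apply/seteqP; split => y /=; rewrite in_itv.
apply: (@ge0_integral_le_sublevels _ (qspace d) _ mu D (d x)) => //.
  by apply: measurable_funS (measurable_qdist x).
move=> n; set E := D `&` _.
(* The supremum below is meaningful only for a nonempty set. *)
have [->|/set0P[y0 [Dy0 y0n]]] := eqVneq E set0.
  by rewrite integral_set0 mule_ge0 ?frac_maximal_ge0// lee_fin powR_ge0.
have supS : has_sup [set d x y | y in E].
  by split; [exists (d x y0), y0|exists n%:R => _ [y [_ /ltW]] yn <-].
set s := sup [set d x y | y in E].
have s0 : 0 < s.
  apply: (@lt_le_trans _ _ (d x y0)); last first.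
    by apply: ub_le_sup; [case: supS|exists y0].
  by apply: qvol_gt0_qdist; case/andP: Dy0.
have s20 : 0 < s / 2 by rewrite divr_gt0.
have [_ [y [Dy yn] <-]] := sup_adherent s20 supS.
rewrite -/s {1}(splitr s) addrK => sy.
have dy0 : 0 < d x y := lt_trans s20 sy.
have Br0 : 0 < 2 * d x y by rewrite mulr_gt0.
apply: (@le_trans _ _ (\int[mu]_(y in qball d x (2 * d x y)) `|f y|%:E)%E).
  apply: ge0_subset_integral => //.
  - rewrite /E (_ : [set y | _] = qball d x n%:R)//.
    by apply: measurableI => //; exact: measurable_qball.
  - exact: measurable_qball.
  move=> z Ez; rewrite /qball/=; apply: (@le_lt_trans _ _ s).
    by apply: ub_le_sup; [case: supS|exists z].
  by rewrite mulrC -ltr_pdivrMr.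
apply: le_trans (integral_qball_le a x _ _ Br0 _) _.
  by rewrite /qball/=; case: hX => -[_ /(_ x x)[_ ->]].
rewrite lee_wpmul2r ?frac_maximal_ge0// lee_fin.
have a10 : 0 <= 1 - a by rewrite subr_ge0.
apply: (ge0_ler_powR a10); rewrite ?nnegrE ?fine_ge0//.
  by rewrite mulr_ge0 ?(le_trans _ Cmu1)// ltW.
apply: le_trans (doublingr x _ dy0) _.
by rewrite ler_wpM2l ?(le_trans _ Cmu1)//; case/andP: Dy.
Qed.

(** * The kernel of the fractional integral on levels of V *)

Variable eta : R.
Hypothesis eta01 : 0 < eta < 1.

Let g (x : X) (y : qspace d) : \bar R := (`|f y / qvol x y `^ (1 - eta)|)%:E.

Let g0 x y : (0 <= g x y)%E. Proof. by rewrite lee_fin. Qed.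

Lemma measurable_frac_integrand (x : X) :
  measurable_fun setT (fun y : qspace d => f y / qvol x y `^ (1 - eta)).
Proof.
apply: measurable_funM => //.
under eq_fun do rewrite -powRN.
exact: measurableT_comp (measurable_powR _) (measurable_qvol x).
Qed.

Let mg x (D : set (qspace d)) : measurable_fun D (g x).
Proof.
apply/measurable_EFinP/measurableT_comp => //.
exact: measurable_funS (measurable_frac_integrand x).
Qed.

Lemma integral_annulus_le (a s : R) (x : X) (E : set (qspace d)) :
  0 <= a <= 1 -> 0 < s -> measurable E ->
  E `<=` [set y | s <= qvol x y <= expR 1 * s] ->
  (\int[mu]_(y in E) g x y <=
   (expR 1 * Cmu * s `^ (eta - a))%:E * frac_maximal mu a f x)%E.
Proof.
move=> /andP[a0 a1] s0 mE Es.
have C0 : 0 < Cmu := lt_le_trans ltr01 Cmu1.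
have es0 : 0 < expR 1 * s by rewrite mulr_gt0 ?expR_gt0.
have mD : measurable ([set y | 0 < qvol x y <= expR 1 * s] : set (qspace d)).
  rewrite (_ : [set y | _] = setT `&` qvol x @^-1` `]0, expR 1 * s]).
    exact: measurable_qvol.
  by rewrite setTI; apply/seteqP; split => y /=; rewrite in_itv.
apply: (@le_trans _ _ (\int[mu]_(y in E) ((s `^ (eta - 1))%:E * `|f y|%:E))%E).
  apply: ge0_le_integral => //.
  - by apply: measurable_funeM; exact: mabsf.
  move=> y /Es/andP[sy _]; rewrite -EFinM lee_fin normrM mulrC.
  rewrite ler_wpM2r// ger0_norm ?invr_ge0 ?powR_ge0//.
  rewrite -(opprB 1 eta) powRN lef_pV2 ?posrE ?powR_gt0// ?(lt_le_trans s0)//.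
  have e10 : 0 <= 1 - eta by rewrite subr_ge0 ltW//; case/andP: eta01.
  by apply: (ge0_ler_powR e10) => //; rewrite nnegrE ?qvol_ge0 ?ltW.
rewrite ge0_integralZl_EFin ?powR_ge0//.
apply: (@le_trans _ _ ((s `^ (eta - 1))%:E *
    \int[mu]_(y in [set y | (0 < qvol x y <= expR 1 * s)%R]) `|f y|%:E)%E).
  rewrite lee_wpmul2l ?lee_fin ?powR_ge0//.
  apply: ge0_subset_integral => //.
  by move=> y /Es/andP[sy ys] /=; rewrite (lt_le_trans s0 sy).
apply: (@le_trans _ _ ((s `^ (eta - 1))%:E *
    (((Cmu * (expR 1 * s)) `^ (1 - a))%:E * frac_maximal mu a f x))%E).
  by rewrite lee_wpmul2l ?lee_fin ?powR_ge0// integral_qvol_le.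
rewrite muleA -EFinM lee_wpmul2r ?frac_maximal_ge0// lee_fin.
have Ce0 : 0 <= Cmu * expR 1 by rewrite mulr_ge0 ?expR_ge0 ?(ltW C0).
rewrite mulrA powRM// ?(ltW s0)//.
rewrite mulrCA -powRD ?(gt_eqF s0) ?implybT//.
rewrite addrA subrK ler_wpM2r ?powR_ge0// [leRHS]mulrC.
rewrite -[leRHS]powRr1//.
apply: ler_powR; last by rewrite gerBl.
by rewrite -[1]mulr1 ler_pM// -expR0 ler_expR.
Qed.

(** With [a = eta - eps] below [t] and [a = eta + eps] above it, the exponent [eta - a] is [eps] and
    [- eps] respectively, so the layer bounds decay geometrically away from [t] on both sides. *)
Lemma frac_integral_le_split (eps t : R) (x : X) :
  0 < eps -> eps < eta -> eps < 1 - eta -> 0 < t ->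
  (`|frac_integral mu eta f x| <=
   (expR 1 * Cmu * (1 - expR (- eps))^-1)%:E *
   ((t `^ eps)%:E * frac_maximal mu (eta - eps) f x +
    (t `^ (- eps))%:E * frac_maximal mu (eta + eps) f x))%E.
Proof.
move=> eps0 eps_eta eps_eta1 t0; have [eta0 eta1] := andP eta01.
set rho := expR (- eps).
have rho01 : 0 < rho < 1 by rewrite expR_gt0 expR_lt1 oppr_lt0.
have C0 : 0 < expR 1 * Cmu.
  by rewrite mulr_gt0 ?expR_gt0// (lt_le_trans ltr01 Cmu1).
have Mge0 c b : (0 <= (expR 1 * Cmu * t `^ c)%:E * frac_maximal mu b f x)%E.
  by rewrite mule_ge0 ?frac_maximal_ge0// lee_fin mulr_ge0 ?powR_ge0 ?(ltW C0).
have mlnV (D : set (qspace d)) : measurable_fun D (fun y => ln (qvol x y)).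
  apply: (measurable_funS measurableT) => //.
  exact: measurableT_comp (@measurable_ln R) (measurable_qvol x).
pose Dm : set (qspace d) := [set y | 0 < qvol x y < t].
pose Dp : set (qspace d) := [set y | t <= qvol x y].
have mDm : measurable Dm.
  rewrite (_ : Dm = setT `&` qvol x @^-1` `]0, t[).
    exact: measurable_qvol.
  by rewrite setTI; apply/seteqP; split => y /=; rewrite in_itv.
have mDp : measurable Dp.
  rewrite (_ : Dp = setT `&` qvol x @^-1` `[t, +oo[).
    exact: measurable_qvol.
  by rewrite setTI; apply/seteqP; split => y /=; rewrite in_itv/= andbT.
have DmE y : Dm y -> qvol x y = t * expR (- (ln t - ln (qvol x y))).
  by move=> /andP[y0 _]; rewrite opprB expRD expRN !lnK// mulrC divfK// gt_eqF.
have DpE y : Dp y -> qvol x y = t * expR (ln (qvol x y) - ln t).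
  move=> ty; have y0 := lt_le_trans t0 ty.
  by rewrite expRD expRN !lnK// mulrC divfK// gt_eqF.
have gm : (\int[mu]_(y in Dm) g x y <= ((1 - rho)^-1)%:E *
    ((expR 1 * Cmu * t `^ eps)%:E * frac_maximal mu (eta - eps) f x))%E.
  apply: (@ge0_integral_le_geometric _ (qspace d) _ mu Dm
    (fun y => ln t - ln (qvol x y))) => //.
  - by apply: measurable_funB => //; exact: measurable_cst.
  - by move=> y /andP[y0 /ltW yt]; rewrite subr_ge0 ler_ln.
  move=> n; set L := _ `&` _.
  (* Layer [n] lies between [t * expR (- n.+1)] and [t * expR (- n)]. Its lower end gives
     [rho ^+ n.+1], which is at most the required [rho ^+ n]. *)
  have s0 : 0 < t * expR (- n.+1%:R) by rewrite mulr_gt0 ?expR_gt0.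
  have mL : measurable L.
    rewrite /L (_ : [set y | _] =
        (fun y => ln t - ln (qvol x y)) @^-1` `[n%:R, n.+1%:R[).
      by apply: measurable_funB => //; exact: measurable_cst.
    by apply/seteqP; split => y /=; rewrite in_itv.
  apply: le_trans (integral_annulus_le (eta - eps) _ x L _ s0 mL _) _.
  - by apply/andP; split; lra.
  - move=> y [/DmE yE /= /andP[ny yn]]; rewrite yE mulrCA -expRD.
    by rewrite !ler_pM2l// !ler_expR; apply/andP; split; lra.
  rewrite muleA -EFinM lee_wpmul2r ?frac_maximal_ge0// lee_fin.
  rewrite mulrCA ler_wpM2l ?(ltW C0)// [leRHS]mulrC.
  rewrite opprB addrCA subrr addr0 powRM ?expR_ge0 ?(ltW t0)//.
  rewrite ler_wpM2l ?powR_ge0// -expRM -expRM_natl ler_expR -natr1; nra.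
have gp : (\int[mu]_(y in Dp) g x y <= ((1 - rho)^-1)%:E *
    ((expR 1 * Cmu * t `^ (- eps))%:E * frac_maximal mu (eta + eps) f x))%E.
  apply: (@ge0_integral_le_geometric _ (qspace d) _ mu Dp
    (fun y => ln (qvol x y) - ln t)) => //.
  - by apply: measurable_funB => //; exact: measurable_cst.
  - by move=> y ty; rewrite subr_ge0 ler_ln// posrE (lt_le_trans t0 ty).
  move=> n; set L := _ `&` _.
  (* Above [t] the lower end of layer [n] is [t * expR n], which gives [rho ^+ n] exactly. *)
  have s0 : 0 < t * expR n%:R by rewrite mulr_gt0 ?expR_gt0.
  have mL : measurable L.
    rewrite /L (_ : [set y | _] =
        (fun y => ln (qvol x y) - ln t) @^-1` `[n%:R, n.+1%:R[).
      by apply: measurable_funB => //; exact: measurable_cst.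
    by apply/seteqP; split => y /=; rewrite in_itv.
  apply: le_trans (integral_annulus_le (eta + eps) _ x L _ s0 mL _) _.
  - by apply/andP; split; lra.
  - move=> y [/DpE yE /= /andP[ny yn]]; rewrite yE mulrCA -expRD.
    by rewrite !ler_pM2l// !ler_expR; apply/andP; split; lra.
  rewrite muleA -EFinM lee_wpmul2r ?frac_maximal_ge0// lee_fin.
  rewrite mulrCA ler_wpM2l ?(ltW C0)// [leRHS]mulrC.
  rewrite opprD addNKr powRM ?expR_ge0 ?(ltW t0)//.
  by rewrite ler_wpM2l ?powR_ge0// -expRM -expRM_natl ler_expR; lra.
apply: le_trans (le_abse_integral _ _ _) _ => //.
  have /measurable_EFinP h := measurable_frac_integrand x.
  exact: h.
have -> : (\int[mu]_y `|(f y / qvol x y `^ (1 - eta))%:E| =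
           \int[mu]_(y in Dm `|` Dp) g x y)%E.
  rewrite integral_mkcond [RHS]integral_mkcond; apply: eq_integral => y _.
  rewrite patchT ?inE// /patch; case: ifPn => //; rewrite notin_setE => nD.
  (* Outside [Dm] and [Dp] the volume is 0, and the integrand vanishes by the convention
     [0^-1 = 0]. *)
  have /eqP -> : qvol x y == 0.
    rewrite eq_le qvol_ge0 andbT leNgt; apply/negP => y0; apply: nD.
    by have [ty|yt] := lerP t (qvol x y); [right|left; apply/andP].
  by rewrite powR0 ?invr0 ?mulr0 ?abse0// subr_eq0 gt_eqF.
rewrite ge0_integral_setU//.
- apply: le_trans (leeD gm gp) _.
  rewrite -ge0_muleDr//.
  have -> : ((expR 1 * Cmu / (1 - rho))%:E =
             ((1 - rho)^-1)%:E * (expR 1 * Cmu)%:E)%E by rewrite -EFinM mulrC.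
  rewrite -muleA lee_wpmul2l//.
    by rewrite lee_fin invr_ge0 subr_ge0 ltW//; case/andP: rho01.
  rewrite ge0_muleDr ?mule_ge0 ?frac_maximal_ge0 ?lee_fin ?powR_ge0//.
  by rewrite !muleA -!EFinM.
- apply/eqP/seteqP; split => // y /= [/andP[_ yt] ty].
  by move: (lt_le_trans yt ty); rewrite ltxx.
Qed.

End doubling.
End maximal.
End homogeneous.

(** * Optimisation of the threshold *)

Theorem proposition5p1 (R : realType) (X : pointedType) (d : X -> X -> R)
    (mu : {measure set (qspace d) -> \bar R})
    (hX : reverse_doubling_space mu)
    (eta : R) (heta : 0 < eta < 1)
    (eps : R) (heps : 0 < eps < Num.min eta (1 - eta)) :
  exists2 C : R, 0 < C &
    forall f : qspace d -> R, L1loc mu f ->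
    forall x : X,
      (`| frac_integral mu eta f x | <=
        C%:E * (frac_maximal mu (eta - eps) f x *
                frac_maximal mu (eta + eps) f x) `^ (2^-1))%E.
Proof.
case: hX => hX _; have [_ _ [Cmu Cmu1 doubling]] := hX.
move: heps => /andP[eps0]; rewrite lt_min => /andP[eps_eta eps_eta1].
set K := expR 1 * Cmu * (1 - expR (- eps))^-1.
have K0 : 0 < K.
  rewrite !mulr_gt0 ?expR_gt0 ?(lt_le_trans ltr01 Cmu1)//.
  by rewrite invr_gt0 subr_gt0 expR_lt1 oppr_lt0.
(* The factor 2 counts the two terms of the splitting, each equal to the square root of the product
   at the optimal [t]. *)
exists (2 * K); first by rewrite mulr_gt0.
move=> f [mf _] x.
have split (t : R)  : 0 < t -> _ :=
  frac_integral_le_split hX f mf Cmu Cmu1 doubling eta heta eps t x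
    eps0 eps_eta eps_eta1.
move: (frac_maximal_eq0 hX f (eta - eps) (eta + eps) x) split.
move: (frac_maximal_eq0 hX f (eta + eps) (eta - eps) x).
move: (frac_maximal_ge0 hX f (eta - eps) x)
  (frac_maximal_ge0 hX f (eta + eps) x).
set p := frac_maximal _ (_ - _) _ _; set q := frac_maximal _ (_ + _) _ _.
move=> p0 q0 qp pq split.
(* The product of 0 and [+oo] is 0, so a zero factor would make the right side vanish. But then both
   factors are zero, and the splitting at [t = 1] gives 0 on the left. *)
have [p_eq0|p_neq0] := eqVneq p 0%E.
  have := split 1 ltr01; rewrite -/p -/q (pq p_eq0) p_eq0 !mule0 adde0 mule0.
  by move/le_trans; apply; rewrite mule_ge0 ?poweR_ge0// lee_fin mulr_ge0 ?ltW.
have [q_eq0|q_neq0] := eqVneq q 0%E.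
  by rewrite (qp q_eq0) eqxx in p_neq0.
have {p0}p0 : (0 < p)%E by rewrite lt_def p_neq0.
have {q0}q0 : (0 < q)%E by rewrite lt_def q_neq0.
(* Both factors are now positive, so an infinite one makes the product infinite and the bound
   trivial. Otherwise both are positive reals with logarithms. *)
have [pqy|pq_neqy] := eqVneq (p * q)%E +oo%E.
  by rewrite pqy poweRyr// gt0_muley ?leey// lte_fin mulr_gt0.
have pfin : p \is a fin_num.
  rewrite ge0_fin_numE ?(ltW p0)// ltey; apply: contra_neq pq_neqy => ->.
  exact: gt0_mulye.
have qfin : q \is a fin_num.
  rewrite ge0_fin_numE ?(ltW q0)// ltey; apply: contra_neq pq_neqy => ->.
  exact: gt0_muley.
have p'0 : 0 < fine p by rewrite -lte_fin fineK.
have q'0 : 0 < fine q by rewrite -lte_fin fineK.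
(* The choice of [t] equates the two terms of the splitting. *)
pose t := expR ((ln (fine q) - ln (fine p)) / (2 * eps)).
apply: le_trans (split t (expR_gt0 _)) _.
rewrite -/p -/q -(fineK pfin) -(fineK qfin) -!EFinM lee_fin -/K.
rewrite (mulrC 2) -[leRHS]mulrA ler_wpM2l ?(ltW K0)//.
set lp := ln (fine p); set lq := ln (fine q).
have -> : fine p = expR lp by rewrite lnK.
have -> : fine q = expR lq by rewrite lnK.
rewrite -[t]/(expR ((lq - lp) / (2 * eps))).
rewrite -expRD -!expRM -!expRD.
have -> : (lq - lp) / (2 * eps) * eps + lp = (lp + lq) / 2 by field; lra.
have -> : (lq - lp) / (2 * eps) * - eps + lq = (lp + lq) / 2 by field; lra.
by rewrite mulr_natl mulr2n.
Qed.
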